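(* Let $X_1,X_2,\ldots$ be independent random variables with a common continuous distribution function $F$, and let $\Pi$ be the set of feasible on-line alternating selection policies, with $A^o_n(\pi)$ the number of selections made by $\pi\in\Pi$ up to and including time $n$. For each $n=1,2,\ldots$ there is a policy $\pi^*_n\in\Pi$ such that $$\mathbb{E}[A^o_n(\pi^*_n)]=\sup_{\pi\in\Pi}\mathbb{E}[A^o_n(\pi)].$$ Moreover, there is a constant $C$ (not depending on $n$) with $C<11-4\sqrt{2}$ such that, for such optimal policies, for all $n\geq 1$, $$(2-\sqrt{2})\,n\;\leq\;\mathbb{E}[A^o_n(\pi^*_n)]\;\leq\;(2-\sqrt{2})\,n+C.$$ In particular, $\mathbb{E}[A^o_n(\pi^*_n)]\sim(2-\sqrt{2})\,n$ as $n\to\infty$.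
   Context: A finite or infinite sequence $z_1,z_2,z_3,\ldots$ of real numbers is called alternating if $z_1<z_2>z_3<z_4>\cdots$ (a sequence of length $0$ or $1$ is alternating). Let $\mathcal{F}_i=\sigma\{X_1,\ldots,X_i\}$. A feasible policy $\pi\in\Pi$ is a sequence of stopping times $\tau_1,\tau_2,\ldots$ with respect to $(\mathcal{F}_i)_{i\ge1}$, with values in $\{1,2,\ldots\}\cup\{\infty\}$, strictly increasing as long as they are finite ($\tau_k$ is the index of the $k$-th selection, $\tau_k=\infty$ meaning that no $k$-th selection is made), such that the selected subsequence $X_{\tau_1},X_{\tau_2},\ldots$ (over those $k$ with $\tau_k<\infty$) is alternating. Thus the decision to select $X_i$ is made at time $i$ using only $X_1,\ldots,X_i$. For $\pi\in\Pi$, $A^o_n(\pi)$ is the number of $k$ with $\tau_k\leq n$. Policies may depend on the known sample size $n$. *)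

(* Defs.v *)
From HB Require Import structures.
From mathcomp Require Export all_boot all_order all_algebra finmap.
From mathcomp Require Export all_classical all_reals all_analysis.

Set Implicit Arguments.
Unset Strict Implicit.
Unset Printing Implicit Defensive.

Export Order.TTheory GRing.Theory Num.Theory numFieldNormedType.Exports.

Open Scope classical_set_scope.
Open Scope ring_scope.

(* Times and selection ranks are counted from 0: [X i] is the observation
   usually written X_{i+1}, and [tau k] is the time of the (k+1)-st selection.
   A time in N u {oo} is an [option nat], with [None] standing for oo. *)

Definition time_le (t : option nat) (i : nat) : bool :=
  if t is Some j then (j <= i)%N else false.

Section alternating_selection.
Context d (T : measurableType d) (R : realType).

Definition independent_seq (P : probability T R) (X : nat -> {RV P >-> R}) :
    Prop :=
  forall (J : {fset nat}) (B : nat -> set R),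
    (forall j, measurable (B j)) ->
    P (\bigcap_(j in [set` J]) (X j @^-1` B j)) =
    (\prod_(j <- J) P (X j @^-1` B j))%E.

Definition natural_filtration (X : nat -> T -> R) (i : nat) : set_system T :=
  <<s \bigcup_(j in [set j | (j <= i)%N])
        preimage_set_system setT (X j) measurable >>.

Definition stopping_time (G : nat -> set_system T) (t : T -> option nat) :
    Prop :=
  forall i, G i [set w | time_le (t w) i].

Definition strictly_increasing_while_finite (tau : nat -> option nat) : Prop :=
  forall k,
    match tau k, tau k.+1 return Prop with
    | Some i, Some j => (i < j)%N
    | None, Some _ => False
    | _, None => True
    end.

(* [x] restricted to the finite times of [tau] satisfies
   x_{tau 0} < x_{tau 1} > x_{tau 2} < ... *)
Definition alternating_along (x : nat -> R) (tau : nat -> option nat) : Prop :=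
  forall k i j, tau k = Some i -> tau k.+1 = Some j ->
    if odd k then x j < x i else x i < x j.

Definition feasible (X : nat -> T -> R) (tau : nat -> T -> option nat) : Prop :=
  [/\ forall k, stopping_time (natural_filtration X) (tau k),
      forall w, strictly_increasing_while_finite (tau ^~ w) &
      forall w, alternating_along (X ^~ w) (tau ^~ w)].

(* Number of selections among the first [n] observations, i.e. at the times
   0, ..., n-1. For a feasible [tau] the set is finite; [fset_set] would send an
   infinite set to the empty one. *)
Definition selections (n : nat) (tau : nat -> T -> option nat) (w : T) : R :=
  (#|` fset_set [set k | exists2 i, tau k w = Some i & (i < n)%N]|)%:R.

Definition optimal (P : probability T R) (X : nat -> T -> R) (n : nat)
    (tau : nat -> T -> option nat) : Prop :=
  feasible X tau /\
  ('E_P[selections n tau] =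
   ereal_sup [set 'E_P[selections n rho] | rho in feasible X])%E.

End alternating_selection.

(* Main.v *)
(* Put U_i = F(X_i) or 1 - F(X_i) according to the direction of the next
   selection, so that the i-th observation is a uniform mark U_i, selectable only
   if it is above the current level y; selecting it changes the level to 1 - U_i.
   Hence with m observations to come the maximal expected number of further
   selections satisfies
     v_(m+1)(y) = int_0^y v_m(y) du + int_y^1 max(v_m(y), 1 + v_m(1 - u)) du,
   and sup_pi E[A_n(pi)] = v_n(0) is attained by the greedy policy of this
   recursion. With xi = 1 - sqrt 2 / 2, the policy selecting the marks above
   max(y, xi) has average reward 2 xi = 2 - sqrt 2, and its relative value function
   h is explicit: h = 0 on [0, xi] and
     h(y) = (ln (y (1 - y)) - 1 / (1 - y)) / 2 + cst on [xi, 1 - xi].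
   Freezing h at h(1 - xi) = -1 above 1 - xi, one has -1 <= h <= 0, and induction
   on m gives 2 xi m + h(y) <= v_m(y) for y <= 1 - xi and
   v_m(y) <= 2 xi m + 1 + h(y) for all y, so that C = 1 works. *)
From HB Require Import structures.
Require Import Defs.
From mathcomp Require Import measurable_realfun ring lra.

Set Implicit Arguments.
Unset Strict Implicit.
Unset Printing Implicit Defensive.

(** * The relative value function *)

Section relative_value.
Context {R : realType}.
Implicit Types c u y : R.

Definition xi : R := 1 - Num.sqrt 2 / 2.

Lemma sqrt2_sq : Num.sqrt 2 * Num.sqrt 2 = 2 :> R.
Proof. by rewrite -expr2 sqr_sqrtr. Qed.

Lemma sqrt2_bounds : (7 / 5 < Num.sqrt 2 :> R) && (Num.sqrt 2 < 3 / 2 :> R).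
Proof.
have := sqrt2_sq; have : 0 <= Num.sqrt 2 :> R := sqrtr_ge0 _.
set s := Num.sqrt 2 => s0 ss; apply/andP; split; nra.
Qed.

Lemma xi_bounds : 1 / 4 < xi < 3 / 10.
Proof. by rewrite /xi; have := sqrt2_bounds; lra. Qed.

(** The point at which the relative value is frozen. In the induction for the value bounds it is
    also the selection threshold attached to level y; it equals max(y, xi) for y at most 1 - xi. *)
Definition clamp y : R := Num.max xi (Num.min y (1 - xi)).

Lemma clamp_itv y : xi <= clamp y <= 1 - xi.
Proof.
rewrite /clamp le_max lexx/= ge_max ge_min lexx orbT andbT.
by have := xi_bounds; lra.
Qed.

Lemma clampK c : xi <= c <= 1 - xi -> clamp c = c.
Proof. by move=> /andP[c1 c2]; rewrite /clamp min_l// max_r. Qed.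

Lemma clamp_le y : y <= xi -> clamp y = xi.
Proof.
move=> yx; rewrite /clamp max_l// (le_trans _ yx)//.
by rewrite ge_min lexx.
Qed.

Lemma clamp_ge y : 1 - xi <= y -> clamp y = 1 - xi.
Proof.
move=> yx; rewrite /clamp min_r// max_r//.
by have := xi_bounds; lra.
Qed.

Lemma continuous_clamp : continuous clamp.
Proof.
move=> y; apply: (@continuous_max R R (cst xi) (fun z => Num.min z (1 - xi))).
  exact: cst_continuous.
apply: (@continuous_min R R id (cst (1 - xi))); first exact: cvg_id.
exact: cst_continuous.
Qed.

(** A solution of (1 - y) h'(y) = h(y) - h(1 - y) - 1, the derivative of the average-reward
    equation. The constants are ln(xi (1 - xi)) and 1 / (1 - xi), so that the value at xi is 0. *)
Definition phi y : R :=
  (ln y + ln (1 - y) - ln ((Num.sqrt 2 - 1) / 2) - (1 - y)^-1 + Num.sqrt 2) / 2.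

Lemma invr1xi : (1 - xi)^-1 = Num.sqrt 2.
Proof.
have := xi_bounds => x0.
have : (1 - xi) * Num.sqrt 2 = 1 by rewrite /xi; have := sqrt2_sq; nra.
by move=> e; apply: (mulfI (x := 1 - xi)); rewrite ?e ?mulfV//; apply/eqP; lra.
Qed.

Lemma lnxi : ln xi + ln (1 - xi) = ln ((Num.sqrt 2 - 1) / 2).
Proof.
have := xi_bounds => x0.
rewrite -lnM ?posrE; [|lra|lra]; congr ln.
by rewrite /xi; have := sqrt2_sq; nra.
Qed.

Lemma phi_xi : phi xi = 0.
Proof. by rewrite /phi lnxi invr1xi; lra. Qed.

Lemma phi_1xi : phi (1 - xi) = -1.
Proof.
have := xi_bounds => x0.
rewrite /phi (subKr 1 xi) (addrC (ln (1 - xi))) lnxi.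
have -> : xi^-1 = 2 + Num.sqrt 2.
  have : xi * (2 + Num.sqrt 2) = 1 by rewrite /xi; have := sqrt2_sq; nra.
  by move=> e; apply: (mulfI (x := xi)); rewrite ?e ?mulfV//; apply/eqP; lra.
by lra.
Qed.

(** Both [phi] and its slope vanish at xi, so the estimate must be tight to first order there. The
    bound ln r <= r - 1 with r = y (1 - y) / (xi (1 - xi)) is, since r = 1 at xi; it leaves a cubic
    inequality. *)
Lemma phi_le0 y : xi <= y <= 1 - xi -> phi y <= 0.
Proof.
have := xi_bounds => x0 yx.
have y0 : 0 < y by lra.
have y1 : 0 < 1 - y by lra.
have k0 : 0 < (Num.sqrt 2 - 1) / 2 :> R by have := sqrt2_bounds; lra.
have lnE : ln y + ln (1 - y) - ln ((Num.sqrt 2 - 1) / 2) =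
    ln (y * (1 - y) / ((Num.sqrt 2 - 1) / 2)).
  by rewrite -lnM ?posrE// -ln_div ?posrE// mulr_gt0.
have r0 : 0 < y * (1 - y) / ((Num.sqrt 2 - 1) / 2) by apply: divr_gt0 => //; apply: mulr_gt0.
have := @le_ln1Dx R (y * (1 - y) / ((Num.sqrt 2 - 1) / 2) - 1).
rewrite subrKC => lnr; have {}lnr := lnr ltac:(lra).
have iy : (1 - y) * (1 - y)^-1 = 1 by rewrite mulfV// gt_eqF.
suff : y * (1 - y) / ((Num.sqrt 2 - 1) / 2) - 1 <= (1 - y)^-1 - Num.sqrt 2.
  by rewrite /phi lnE; lra.
have -> : ((Num.sqrt 2 - 1) / 2)^-1 = 2 * (Num.sqrt 2 + 1) :> R.
  apply: (mulfI (lt0r_neq0 k0)); rewrite mulfV ?gt_eqF//.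
  by have := sqrt2_sq; nra.
rewrite -(ler_pM2r y1) [leRHS]mulrBl mulVf ?gt_eqF// -subr_ge0.
set s := Num.sqrt 2.
have ss : s * s = 2 := sqrt2_sq.
have /andP[s1 s2] := sqrt2_bounds.
(* The cubic has a double root at 1 - y = 1 - xi = sqrt 2 / 2. *)
have -> : 1 - s * (1 - y) - (y * (1 - y) * (2 * (s + 1)) - 1) * (1 - y) =
    2 * (s + 1) * (1 - y - s / 2) ^+ 2 * (1 - y + (s - 1)) +
    (s * s - 2) * ((3 * s - 1) / 2 * (1 - y) - (s * s + 1) / 2).
  by field.
rewrite ss subrr mul0r addr0; rewrite -/s in s1 s2.
by apply: mulr_ge0; [apply: mulr_ge0; [lra|exact: sqr_ge0]|lra].
Qed.

(** Both y (1 - y) and - 1 / (1 - y) are minimal at y = 1 - xi on this interval, so the bound is the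
    value there. *)
Lemma phi_ge y : xi <= y <= 1 - xi -> -1 <= phi y.
Proof.
have := xi_bounds => x0 yx.
have y0 : 0 < y by lra.
have y1 : 0 < 1 - y by lra.
have ler : (Num.sqrt 2 - 1) / 2 <= y * (1 - y).
  by have -> : (Num.sqrt 2 - 1) / 2 = xi * (1 - xi) :> R by [rewrite /xi; have := sqrt2_sq; nra]; nra.
have k0 : 0 < (Num.sqrt 2 - 1) / 2 :> R by have := sqrt2_bounds; lra.
have : ln ((Num.sqrt 2 - 1) / 2) <= ln y + ln (1 - y).
  by rewrite -lnM ?posrE// ler_ln ?posrE// mulr_gt0.
have : (1 - y)^-1 <= xi^-1 by rewrite lef_pV2 ?posrE; lra.
by have := phi_1xi; rewrite /phi (subKr 1 xi) (addrC (ln (1 - xi))) lnxi; lra.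
Qed.

Lemma is_derive_phi y : 0 < y -> y < 1 ->
  is_derive y 1 phi ((y^-1 - (1 - y)^-1 - (1 - y) ^- 2) / 2).
Proof.
move=> y0 y1; have y1' : 0 < 1 - y by lra.
have d1 : is_derive y 1 (fun z => 1 - z) (-1 : R).
  by apply: is_derive_eq; rewrite add0r mul1r.
have d2 : is_derive y 1 (fun z => ln (1 - z)) (- (1 - y)^-1).
  have := @is_derive1_comp R (@ln R) (fun z => 1 - z) y _ _ (is_derive1_ln y1') d1.
  by move/is_derive_eq; apply; rewrite mulrN1.
have d3 : is_derive y 1 (fun z => (1 - z)^-1) ((1 - y) ^- 2).
  have := @is_deriveV R (fun z => 1 - z) y _ 1 (lt0r_neq0 y1') d1.
  by move/is_derive_eq; apply; rewrite /GRing.scale/= mulrN1 opprK.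
have d4 := is_derive1_ln y0.
apply: is_derive_eq.
by rewrite /GRing.scale/=; lra.
Qed.

(* [x |-> - (1 - x) * phi x] is an antiderivative of [x |-> 1 + phi (1 - x)]. *)
Lemma integral_phi c : xi <= c <= 1 - xi ->
  (\int[lebesgue_measure]_(x in `[c, (1 - xi)%R]) (1 + phi (1 - x))%:E =
  ((1 - c) * phi c + xi)%:E)%E.
Proof.
(* The degenerate interval is treated apart, because the fundamental theorem of calculus is applied
   with c < 1 - xi. *)
have := xi_bounds => x0 /andP[c0]; rewrite le_eqVlt => /predU1P[->|c1].
  by rewrite set_itv1 integral_set1 subKr phi_1xi mulrN1 addNr.
pose A x := - (1 - x) * phi x.
have dA x : c <= x <= 1 - xi -> is_derive x 1 A (1 + phi (1 - x)).
  move=> cx; have dphi := @is_derive_phi x ltac:(lra) ltac:(lra).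
  have i0 : x * x^-1 = 1 by rewrite mulfV// gt_eqF//; lra.
  have i1 : (1 - x) * (1 - x)^-1 = 1 by rewrite mulfV// gt_eqF//; lra.
  apply: is_derive_eq; rewrite /GRing.scale/= /phi (subKr 1 x) -exprVn expr2.
  move: i0 i1; set i := x^-1; set j := (1 - x)^-1 => i0 i1.
  set l := ln _; set l' := ln _; set k := ln _.
  by have i2 : (1 - x) * (j * j) = j; [rewrite mulrA i1 mul1r|lra].
rewrite (@continuous_FTC2 _ _ A)//.
- by rewrite /A phi_1xi -EFinB; congr EFin; lra.
- apply: derivable_within_continuous => x; rewrite in_itv/= => cx.
  have ? := @is_derive_phi (1 - x) ltac:(lra) ltac:(lra).
  have ? : derivable (phi \o (fun z => 1 - z)) x 1.
    have d1 : is_derive x 1 (fun z => 1 - z) (-1 : R).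
      by apply: is_derive_eq; rewrite add0r mul1r.
    by have [] := @is_derive1_comp R phi (fun z => 1 - z) x _ _ _ d1.
  by apply: derivableD.
- have cA x : c <= x <= 1 - xi -> A z @[z --> x] --> A x.
    move=> /dA[? _]; exact/differentiable_continuous/derivable1_diffP.
  split.
  + by move=> x; rewrite in_itv/= => /andP[cx xc]; have [] := dA x; rewrite ?ltW.
  + by apply: cvg_at_right_filter; apply: cA; rewrite lexx ltW.
  + by apply: cvg_at_left_filter; apply: cA; rewrite lexx ltW.
- move=> x; rewrite in_itv/= => /andP[cx xc].
  by rewrite derive1E; apply: derive_val; apply: dA; rewrite !ltW.
Qed.

(* The relative value function h, frozen at its endpoint values outside [xi, 1 - xi]. *)
Definition relval y : R := phi (clamp y).

Lemma relval_le0 y : relval y <= 0.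
Proof. exact/phi_le0/clamp_itv. Qed.

Lemma relval_geN1 y : -1 <= relval y.
Proof. exact/phi_ge/clamp_itv. Qed.

Lemma relval_clamp y : relval (clamp y) = relval y.
Proof. by rewrite /relval (clampK (clamp_itv y)). Qed.

Lemma relval_le y : y <= xi -> relval y = 0.
Proof. by move=> yx; rewrite /relval clamp_le// phi_xi. Qed.

Lemma relval_ge y : 1 - xi <= y -> relval y = -1.
Proof. by move=> yx; rewrite /relval clamp_ge// phi_1xi. Qed.

Lemma measurable_relval : measurable_fun setT relval.
Proof.
apply: continuous_measurable_fun => y.
apply: (@continuous_comp R R R clamp phi y); first exact: continuous_clamp.
have := clamp_itv y; have := xi_bounds => x0 cx.
have [? _] := @is_derive_phi (clamp y) ltac:(lra) ltac:(lra).
exact/differentiable_continuous/derivable1_diffP.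
Qed.

(** The average-reward equation with reward 2 xi per step. One xi comes from [integral_phi]; the
    other is the mass of the marks above 1 - xi, which lead to a level below xi, of relative value
    0. *)
Lemma integral_relval c : xi <= c <= 1 - xi ->
  (\int[lebesgue_measure]_(x in `[c, 1%R]) (1 + relval (1 - x))%:E =
  ((1 - c) * relval c + 2 * xi)%:E)%E.
Proof.
move=> cx; have := xi_bounds => x0.
have cE : `[c, 1]%classic = `[c, 1 - xi] `|` `]1 - xi, 1].
  by rewrite -itv_bndbnd_setU// bnd_simp; lra.
rewrite cE ge0_integral_setU//=; last 3 first.
- apply/measurable_EFinP/measurable_funTS/measurable_funD => //.
  by apply: measurableT_comp => //; [exact: measurable_relval|exact: measurable_funB].
- by move=> x _; rewrite lee_fin; have := relval_geN1 (1 - x); lra.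
- by apply/disj_set2P/seteqP; split=> // x []; rewrite /= !in_itv/=; lra.
have -> : (\int[lebesgue_measure]_(x in `[c, (1 - xi)%R]) (1 + relval (1 - x))%:E =
    \int[lebesgue_measure]_(x in `[c, (1 - xi)%R]) (1 + phi (1 - x))%:E)%E.
  apply: eq_integral => x; rewrite inE/= in_itv/= => cx'.
  by rewrite /relval clampK//; lra.
have -> : (\int[lebesgue_measure]_(x in `](1 - xi)%R, 1%R]) (1 + relval (1 - x))%:E =
    \int[lebesgue_measure]_(x in `](1 - xi)%R, 1%R]) (cst 1%:E x))%E.
  apply: eq_integral => x; rewrite inE/= in_itv/= => cx'.
  by rewrite relval_le ?addr0//; lra.
rewrite integral_phi//.
rewrite integral_cst//= lebesgue_measure_itv/= lte_fin ltrBlDr ltrDl.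
have -> : 0 < xi :> R by lra.
by rewrite mul1e -!EFinD /relval clampK//; congr EFin; lra.
Qed.

End relative_value.

(** * The optimality recursion *)

Section bellman.
Context {R : realType}.
Local Open Scope ereal_scope.
Implicit Types (v : R -> \bar R) (c u y : R) (n : nat).

Definition unif : probability (measurableTypeR R) R := uniform_prob (@ltr01 R).

Definition gain v y u : \bar R :=
  if (y <= u)%R then maxe (v y) (1 + v (1 - u)%R) else v y.

(* The strict version guarantees that the selected observations alternate strictly;
   both have the same integral. *)
Definition gain_lt v y u : \bar R :=
  if (y < u)%R then maxe (v y) (1 + v (1 - u)%R) else v y.

Fixpoint value n y : \bar R :=
  if n is n'.+1 then \int[unif]_u gain (value n') y u else 0.

Lemma integral_unif (f : R -> \bar R) :
  measurable_fun setT f -> (forall x, 0 <= f x) ->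
  \int[unif]_x f x = \int[lebesgue_measure]_(x in `[0%R, 1%R]) f x.
Proof. by move=> mf f0; rewrite integral_uniform// subr0 invr1 mul1e. Qed.

Lemma measurable_onem : measurable_fun [set: R] (fun u => 1 - u)%R.
Proof. exact: measurable_funB. Qed.

Lemma gain_ge0 v y u : (forall z, 0 <= v z) -> 0 <= gain v y u.
Proof. by move=> v0; rewrite /gain; case: ifPn => // _; rewrite le_max v0. Qed.

Lemma gain_lt_ge0 v y u : (forall z, 0 <= v z) -> 0 <= gain_lt v y u.
Proof. by move=> v0; rewrite /gain_lt; case: ifPn => // _; rewrite le_max v0. Qed.

Lemma measurable_gain v : measurable_fun setT v ->
  measurable_fun [set: R * R] (fun z => gain v z.1 z.2).
Proof.
move=> mv; apply: measurable_fun_if => //.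
- by apply: measurable_fun_ler.
- apply: measurable_maxe.
    by apply: measurable_funTS; apply: measurableT_comp.
  apply: measurable_funTS; apply: emeasurable_funD => //.
  apply: (measurableT_comp mv); apply: (measurableT_comp measurable_onem).
  exact: measurable_snd.
- by apply: measurable_funTS; apply: measurableT_comp.
Qed.

Lemma measurable_gain_lt v : measurable_fun setT v ->
  measurable_fun [set: R * R] (fun z => gain_lt v z.1 z.2).
Proof.
move=> mv; apply: measurable_fun_if => //.
- by apply: measurable_fun_ltr.
- apply: measurable_maxe.
    by apply: measurable_funTS; apply: measurableT_comp.
  apply: measurable_funTS; apply: emeasurable_funD => //.
  apply: (measurableT_comp mv); apply: (measurableT_comp measurable_onem).
  exact: measurable_snd.
- by apply: measurable_funTS; apply: measurableT_comp.
Qed.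

Lemma value_ge0 n y : 0 <= value n y.
Proof. by elim: n y => // n IHn y /=; apply: integral_ge0 => u _; exact: gain_ge0. Qed.

Lemma measurable_value n : measurable_fun setT (value n).
Proof.
elim: n => [|n IHn]; first exact: measurable_cst.
apply: (@measurable_fun_fubini_tonelli_F _ _ _ _ R unif (fun z => gain (value n) z.1 z.2)).
  exact: measurable_gain.
by move=> z; apply: gain_ge0 => ?; exact: value_ge0.
Qed.

Lemma measurable_gain1 v y : measurable_fun setT v ->
  measurable_fun [set: R] (gain v y).
Proof.
by move=> /measurable_gain mv; exact: (measurableT_comp mv (measurable_pair1 y)).
Qed.

Lemma measurable_gain_lt1 v y : measurable_fun setT v ->
  measurable_fun [set: R] (gain_lt v y).
Proof.
by move=> /measurable_gain_lt mv; exact: (measurableT_comp mv (measurable_pair1 y)).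
Qed.

Lemma integral_gain_lt v y : measurable_fun setT v -> (forall z, 0 <= v z) ->
  \int[unif]_u gain_lt v y u = \int[unif]_u gain v y u.
Proof.
move=> mv v0; rewrite !integral_unif.
- apply: ae_eq_integral => //.
  + exact: measurable_funTS (measurable_gain_lt1 _ mv).
  + exact: measurable_funTS (measurable_gain1 _ mv).
  + exists [set y]; split => //; first exact: lebesgue_measure_set1.
    move=> u /= guy; apply: contrapT => uy; apply: guy => _.
    by rewrite /gain_lt /gain lt_neqAle eq_sym; case: eqP.
- exact: measurable_gain1.
- by move=> x; apply: gain_ge0.
- exact: measurable_gain_lt1.
- by move=> x; apply: gain_lt_ge0.
Qed.

(* With [c = clamp y], [w = k + relval] and [a = w y], this is the gain of the
   selection rule [u >= c] for the value function [w]. *)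
Definition threshold (c a k u : R) : R :=
  if (u < c)%R then a else (k + (1 + relval (1 - u)))%R.

Lemma measurable_threshold c a k : measurable_fun setT (threshold c a k).
Proof.
apply: measurable_fun_if => //.
- exact: measurable_fun_ltr.
- apply: measurable_funTS; apply: measurable_funD => //; apply: measurable_funD => //.
  by apply: measurableT_comp; [exact: measurable_relval|exact: measurable_onem].
Qed.

(** For c = [clamp y] and a = k + [relval y] the right-hand side collapses to k + 2 xi + [relval y]:
    one step of the threshold rule adds exactly 2 xi. *)
Lemma integral_threshold c a k : (xi <= c <= 1 - xi)%R -> (0 <= a)%R -> (0 <= k)%R ->
  \int[lebesgue_measure]_(u in `[0%R, 1%R]) (threshold c a k u)%:E =
  (c * a + (1 - c) * (k + relval c) + 2 * xi)%:E.
Proof.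
move=> cx a0 k0; have := @xi_bounds R => x0.
have cE : `[0%R, 1%R]%classic = `[0%R, c[ `|` `[c, 1%R].
  by rewrite -itv_bndbnd_setU// bnd_simp; lra.
have t0 u : (0 <= k + (1 + relval (1 - u)))%R.
  by have := relval_geN1 (1 - u); lra.
rewrite cE ge0_integral_setU//=; last 3 first.
- apply/measurable_EFinP; exact: measurable_funTS (measurable_threshold _ _ _).
- by move=> x _; rewrite lee_fin /threshold; case: ifPn.
- by apply/disj_set2P/seteqP; split=> // x []; rewrite /= !in_itv/=; lra.
have -> : \int[lebesgue_measure]_(x in `[0%R, c[) (threshold c a k x)%:E =
    \int[lebesgue_measure]_(x in `[0%R, c[) (cst a%:E x).
  apply: eq_integral => x; rewrite inE/= in_itv/= /threshold => /andP[_ ->] //.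
have -> : \int[lebesgue_measure]_(x in `[c, 1%R]) (threshold c a k x)%:E =
    \int[lebesgue_measure]_(x in `[c, 1%R]) (k%:E + (1 + relval (1 - x))%:E).
  apply: eq_integral => x; rewrite inE/= in_itv/= /threshold => /andP[cx' _].
  by rewrite ltNge cx'.
have m1 : measurable_fun [set: R] (fun x => 1 + relval (1 - x))%R.
  apply: measurable_funD => //.
  by apply: measurableT_comp; [exact: measurable_relval|exact: measurable_onem].
rewrite ge0_integralD//; last 2 first.
- by move=> x _; rewrite lee_fin; have := relval_geN1 (1 - x); lra.
- by apply/measurable_EFinP; exact: measurable_funTS.
rewrite !integral_cst//= integral_relval// !lebesgue_measure_itv/= !lte_fin.
have -> : (0 < c)%R by lra.
have -> : (c < 1)%R by lra.
by rewrite -!EFinD; congr EFin; lra.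
Qed.

Lemma value_ub n y : (0 <= y <= 1)%R ->
  value n y <= (2 * xi * n%:R + 1 + relval y)%:E.
Proof.
have := @xi_bounds R => x0.
elim: n y => [|n IHn] y y01 /=.
  by rewrite mulr0 add0r lee_fin; have := relval_geN1 y; lra.
(* The 1 in k covers n = 0, where the claim is 0 <= 1 + h, and keeps a nonnegative. *)
set k : R := (2 * xi * n%:R + 1)%R; set a : R := (k + relval y)%R.
have k1 : (1 <= k)%R.
  by rewrite /k lerDr mulr_ge0 ?mulr_ge0//; lra.
have a0 : (0 <= a)%R by rewrite /a; have := relval_geN1 y; lra.
have mv := measurable_value n; have v0 := @value_ge0 n.
have -> : (2 * xi * n.+1%:R + 1 + relval y =
    clamp y * a + (1 - clamp y) * (k + relval (clamp y)) + 2 * xi)%R.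
  by rewrite relval_clamp -/a -mulrDl subrKC mul1r /a /k -natr1; lra.
rewrite -integral_threshold//; [|exact: clamp_itv|lra].
rewrite integral_unif; [|exact: measurable_gain1|by move=> u; apply: gain_ge0].
apply: ge0_le_integral => //=.
- by move=> u _; apply: gain_ge0.
- exact: measurable_funTS (measurable_gain1 _ mv).
- by apply/measurable_EFinP; exact: measurable_funTS (measurable_threshold _ _ _).
move=> u; rewrite in_itv/= => u01.
have va : value n y <= a%:E by exact: IHn.
have vu : 1 + value n (1 - u) <= (k + (1 + relval (1 - u)))%:E.
  have -> : (k + (1 + relval (1 - u)) = 1 + (k + relval (1 - u)))%R by lra.
  by rewrite EFinD leeD2l// IHn//; lra.
have ry := relval_le0 y; have ru := relval_geN1 (1 - u).
rewrite /gain /threshold; case: ifPn => [yu|]; case: ifPn => uc; rewrite ?ge_max.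
(* A selectable mark below the threshold: then y and u are at most xi, so h(y) = 0 and h(1 - u) =
   -1, and selecting or rejecting gives the same bound k. *)
- rewrite va/= (le_trans vu)// lee_fin.
  have yx : (y <= xi)%R.
    rewrite leNgt; apply/negP => yx; move: uc; rewrite /clamp lt_max; apply/negP.
    by rewrite negb_or -!leNgt (ltW (lt_le_trans yx _))//= ge_min yu.
  move: uc; rewrite clamp_le// => ux.
  by rewrite /a (relval_le yx) (@relval_ge _ (1 - u)); lra.
(* Above the threshold selecting is at least as good, as h(y) <= 0 <= 1 + h(1 - u). The same
   inequality settles the last case, where y > u >= [clamp y] forces a rejection. *)
- rewrite vu andbT (le_trans va)// lee_fin /a; lra.
- by [].
- rewrite (le_trans va)// lee_fin /a; lra.
Qed.

Lemma value_lb n y : (0 <= y <= 1 - xi)%R ->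
  (2 * xi * n%:R + relval y)%:E <= value n y.
Proof.
have := @xi_bounds R => x0.
elim: n y => [|n IHn] y y01 /=.
  by rewrite mulr0 add0r lee_fin relval_le0.
(* For n = 0 the number k + h(y) can be negative, while [integral_threshold] asks for a nonnegative
   a. Since [value] is nonnegative, truncating at 0 keeps a lower bound. *)
set k : R := (2 * xi * n%:R)%R; set a : R := Num.max 0%R (k + relval y)%R.
have k0 : (0 <= k)%R by rewrite /k mulr_ge0 ?mulr_ge0//; lra.
have a0 : (0 <= a)%R by rewrite le_max lexx.
have ka : (k + relval y <= a)%R by rewrite le_max lexx orbT.
have mv := measurable_value n; have v0 := @value_ge0 n.
have cy := clamp_itv y.
apply: (@le_trans _ _
    (clamp y * a + (1 - clamp y) * (k + relval (clamp y)) + 2 * xi)%:E).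
  rewrite lee_fin relval_clamp.
  have -> : (2 * xi * n.+1%:R = k + 2 * xi)%R by rewrite /k -[n.+1%:R]natr1; lra.
  have : (clamp y * (k + relval y) <= clamp y * a)%R by rewrite ler_wpM2l//; lra.
  lra.
rewrite -integral_threshold//.
rewrite integral_unif; [|exact: measurable_gain1|by move=> u; apply: gain_ge0].
apply: ge0_le_integral => //=.
- move=> u _; rewrite lee_fin /threshold; case: ifPn => // _.
  by have := relval_geN1 (1 - u); lra.
- by apply/measurable_EFinP; exact: measurable_funTS (measurable_threshold _ _ _).
- exact: measurable_funTS (measurable_gain1 _ mv).
move=> u; rewrite in_itv/= => u01.
have va : a%:E <= value n y by rewrite EFin_max ge_max v0 IHn.
rewrite /threshold; case: ifPn => [uc|].
  by rewrite /gain; case: ifPn => // _; rewrite le_max va.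
(* For y <= 1 - xi the threshold is not below the level, so the rule selects only admissible marks.
   The next level 1 - u is again at most 1 - xi, as u >= [clamp y] >= xi, and the induction
   hypothesis applies. *)
rewrite -leNgt => cu; have yc : (y <= clamp y)%R.
  by rewrite /clamp le_max le_min lexx; have /andP[_ ->] := y01; rewrite orbT.
rewrite /gain (le_trans yc cu) le_max; apply/orP; right.
have -> : (k + (1 + relval (1 - u)) = 1 + (k + relval (1 - u)))%R by lra.
by rewrite EFinD leeD2l// IHn//; lra.
Qed.

End bellman.

(** * Uniform marks *)

Section uniform_law.
Context d (T : measurableType d) (R : realType) (P : probability T R).
Local Open Scope ereal_scope.

Lemma unifE (A : set R) : measurable A ->
  unif A = lebesgue_measure (A `&` `[0%R, 1%R]).
Proof.
move=> mA; have := @integral_unif R (fun x => (\1_A x)%:E).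
rewrite integral_indic// setIT => ->.
- by rewrite integral_indic.
- exact/measurable_EFinP/measurable_indic.
- by move=> x; rewrite lee_fin.
Qed.

Lemma unif_ray (x : R) : (0 <= x < 1)%R -> unif `]x, +oo[%classic = (1 - x)%:E.
Proof.
move=> x01; rewrite unifE//.
have -> : `]x, +oo[%classic `&` `[0%R, 1%R]%classic = `]x, 1%R]%classic.
  by apply/seteqP; split=> y /=; rewrite !in_itv/=; lra.
by rewrite lebesgue_measure_itv/= lte_fin; have -> : (x < 1)%R by lra.
Qed.

(** Finite measures that agree on the rays []x, +oo[] are equal. The hypotheses are one-sided, on
    closed and on open rays, because a monotone transform with flat pieces yields just these. *)
Lemma law_unif (W : {mfun T >-> R}) :
  (forall w, 0 <= W w <= 1)%R ->
  (forall x, (0 < x < 1)%R -> (1 - x)%:E <= P [set w | (x <= W w)%R]) ->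
  (forall x, (0 < x < 1)%R -> P [set w | (x < W w)%R] <= (1 - x)%:E) ->
  forall A : set R, measurable A -> P (W @^-1` A) = unif A.
Proof.
move=> W01 Wge Wlt A mA.
have mW (B : set R) : measurable B -> measurable (W @^-1` B).
  by move=> mB; rewrite -[X in measurable X]setTI; exact: measurable_funP.
have U := @measure_unique _ R (measurableTypeR R) (@RGenOInfty.G R)
  (fun n => `](- n%:R)%R, +oo[%classic).
have mWR : measurable_fun setT (W : T -> measurableTypeR R).
  have mW0 : measurable_fun setT (W : T -> R) by exact: measurable_funP.
  by move=> mD Y mY; apply: mW0; [exact: mD|exact: mY].
pose WR : {mfun T >-> measurableTypeR R} :=
  HB.pack (W : T -> measurableTypeR R) (isMeasurableFun.Build _ _ _ _ _ mWR).
apply: (U _ _ _ _ (distribution P WR) unif _ _ A mA) => //.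
- exact: RGenOInfty.measurableE.
- move=> _ _ [x ->] [y ->]; exists (Num.max x y).
  by apply/seteqP; split=> z /=; rewrite !in_itv/= !andbT gt_max => /andP.
- by move=> n; exists (- n%:R)%R.
- rewrite -subTset => x _; exists (Num.truncn `|x|).+1 => //=.
  by rewrite in_itv/= andbT ltrNl (le_lt_trans _ (truncnS_gt _))// ler_normr lexx orbT.
- move=> _ [x ->]; rewrite -[LHS]/(P (W @^-1` `]x, +oo[%classic)) -[RHS]/(unif `]x, +oo[%classic).
  have [x0|x0] := ltP x 0%R.
    rewrite (_ : _ @^-1` _ = setT); last first.
      apply/seteqP; split => // w _ /=; rewrite in_itv/= andbT.
      by have := W01 w; lra.
    rewrite probability_setT unifE// (_ : _ `&` _ = `[0%R, 1%R]%classic); last first.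
      by apply/seteqP; split => y /=; rewrite !in_itv/=; lra.
    by rewrite lebesgue_measure_itv/= lte01 sube0.
  have [x1|x1] := leP 1%R x.
    rewrite (_ : _ @^-1` _ = set0); last first.
      apply/seteqP; split => // w /=; rewrite in_itv/= andbT.
      by have := W01 w; lra.
    rewrite measure0 unifE// (_ : _ `&` _ = set0) ?measure0//.
    by apply/seteqP; split => y //=; rewrite !in_itv/=; lra.
  rewrite unif_ray ?x0//; apply/eqP; rewrite eq_le; apply/andP; split.
    have [->|xn0] := eqVneq x 0%R; first by rewrite subr0; exact: probability_le1 (mW _ _).
    have := Wlt x; rewrite lt_neqAle eq_sym xn0 x0 x1 => /(_ isT); apply: le_trans.
    rewrite le_eqVlt; apply/orP; left; apply/eqP; congr (P _).
    by apply/seteqP; split => w /=; rewrite in_itv/= andbT.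
  (* The closed-ray bound is used at x + e / 2, whose closed ray lies inside the open ray at x. *)
  apply/lee_addgt0Pr => e e0.
  have [e1|e1] := leP (1 - x)%R e.
    by rewrite (@le_trans _ _ e%:E) ?lee_fin// leeDr.
  apply: (@le_trans _ _ ((1 - (x + e / 2))%:E + e%:E)).
    by rewrite -EFinD lee_fin; lra.
  rewrite leeD2r//; apply: le_trans (Wge _ _) _; first by lra.
  apply: le_measure; rewrite ?inE.
  + rewrite (_ : [set w | _] = W @^-1` `[(x + e / 2)%R, +oo[%classic); first exact: mW.
    by apply/seteqP; split => w /=; rewrite in_itv/= andbT.
  + exact: mW.
  + by move=> w /= ?; rewrite in_itv/= andbT; lra.
- move=> n; apply: (@le_lt_trans _ _ 1); last exact: ltry.
  exact: probability_le1 (mW _ _).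
Qed.

End uniform_law.

(** * The probability integral transform, in both directions *)

Section cdf_transform.
Context d (T : measurableType d) (R : realType) (P : probability T R).
Context (X : {RV P >-> R}) (F : R -> R).
Context (F_continuous : continuous F).
Context (X_cdf : forall x, cdf X x = (F x)%:E).

Lemma cdf_itv x : 0 <= F x <= 1.
Proof. by rewrite -!lee_fin -X_cdf cdf_ge0 cdf_le1. Qed.

Lemma cdf_homo : {homo F : x y / x <= y}.
Proof. by move=> x y xy; rewrite -lee_fin -!X_cdf; exact: cdf_nondecreasing. Qed.

(** Intermediate value theorem between the limits 0 and 1, which F need not attain; hence the open
    range of u. *)
Lemma cdf_surj u : 0 < u < 1 -> exists x, F x = u.
Proof.
move=> /andP[u0 u1].
have Ffine : F = fine \o cdf X by apply/funext => x /=; rewrite X_cdf.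
have Fy : F x @[x --> +oo] --> (1 : R).
  by rewrite Ffine; apply: fine_cvg; exact: cvg_cdfy1.
have FNy : F x @[x --> -oo] --> (0 : R).
  by rewrite Ffine; apply: fine_cvg; exact: cvg_cdfNy0.
have [b ub] : exists b, u < F b by near +oo_R => b; exists b; near: b; exact: (cvgr_gt _ Fy).
have [a ua] : exists a, F a < u by near -oo_R => a; exists a; near: a; exact: (cvgr_lt _ FNy).
have ab : a <= b.
  by rewrite leNgt; apply/negP => /ltW/cdf_homo; rewrite leNgt (lt_trans ua ub).
have [|c _ <-] := @IVT _ F a b u ab (continuous_subspaceT F_continuous).
  by rewrite ge_min le_max (ltW ua) (ltW ub) orbT.
by exists c.
Unshelve. all: by end_near.
Qed.

(* [b] tells that the next selection must be larger than the last one. *)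
Definition mark (b : bool) x : R := if b then F x else 1 - F x.

Lemma mark_surj b u : 0 < u < 1 -> exists x, mark b x = u.
Proof.
move=> u01; have [x Fx] := @cdf_surj (if b then u else 1 - u) ltac:(case: (b); lra).
by exists x; rewrite /mark; case: (b) Fx; lra.
Qed.

Lemma mark_itv b x : 0 <= mark b x <= 1.
Proof. by rewrite /mark; have := cdf_itv x; case: b; lra. Qed.

Lemma measurable_mark b : measurable_fun setT (mark b).
Proof.
have mF := continuous_measurable_fun F_continuous.
by case: b => //; apply: measurable_funB.
Qed.

(** As F may be flat, only inclusions hold: with F t = x, the event X > t lies in F X >= x and
    contains F X > x. For the reversed mark F t = 1 - x and X <= t replaces X > t. *)
Lemma mark_unif b (A : set R) : measurable A -> P ((mark b \o X) @^-1` A) = unif A.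
Proof.
have mW : measurable_fun setT (mark b \o X).
  by apply: measurableT_comp => //; exact: measurable_mark.
pose W : {mfun T >-> R} := HB.pack (mark b \o X) (isMeasurableFun.Build _ _ _ _ _ mW).
have mX (B : set R) : measurable B -> measurable (X @^-1` B).
  by move=> mB; rewrite -[Y in measurable Y]setTI; exact: measurable_funP.
have mWs (B : set R) : measurable B -> measurable (W @^-1` B).
  by move=> mB; rewrite -[Y in measurable Y]setTI; exact: measurable_funP.
have Pgt t : P [set w | t < X w] = (1 - F t)%:E.
  have <- : ccdf X t = (1 - F t)%:E by rewrite ccdf_1_cdf X_cdf.
  rewrite /ccdf/= /pushforward; congr (P _).
  by apply/seteqP; split => w /=; rewrite in_itv/= andbT.
have Ple t : P [set w | X w <= t] = (F t)%:E.
  by rewrite -X_cdf /cdf/= /pushforward; congr (P _).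
have mgt t : measurable [set w | t < X w].
  rewrite (_ : [set w | _] = X @^-1` `]t, +oo[%classic); first exact: mX.
  by apply/seteqP; split => w /=; rewrite in_itv/= andbT.
have mle t : measurable [set w | X w <= t].
  rewrite (_ : [set w | _] = X @^-1` `]-oo, t]%classic); first exact: mX.
  by apply/seteqP; split => w /=; rewrite in_itv/=.
have mgtW t : measurable [set w | t < W w].
  rewrite (_ : [set w | _] = W @^-1` `]t, +oo[%classic); first exact: mWs.
  by apply/seteqP; split => w /=; rewrite in_itv/= andbT.
have mgeW t : measurable [set w | t <= W w].
  rewrite (_ : [set w | _] = W @^-1` `[t, +oo[%classic); first exact: mWs.
  by apply/seteqP; split => w /=; rewrite in_itv/= andbT.
apply: (@law_unif _ _ _ P W) => [w|x x01|x x01].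
- exact: mark_itv.
- have [t Ft] := mark_surj b x01.
  have [bE|/negbTE bE] := boolP b; rewrite bE /mark in Ft.
    rewrite -{1}Ft -Pgt; apply: le_measure; rewrite ?inE// => w /= /ltW/cdf_homo.
    by rewrite /mark bE Ft.
  have -> : (1 - x = F t)%R by lra.
  rewrite -Ple; apply: le_measure; rewrite ?inE// => w /= /cdf_homo.
  by rewrite /mark bE; lra.
- have [t Ft] := mark_surj b x01.
  have [bE|/negbTE bE] := boolP b; rewrite bE /mark in Ft.
    rewrite -{2}Ft -Pgt; apply: le_measure; rewrite ?inE// => w /=.
    by apply: contraTT; rewrite -!leNgt /mark bE => /cdf_homo; rewrite Ft.
  have -> : (1 - x = F t)%R by lra.
  rewrite -Ple; apply: le_measure; rewrite ?inE// => w /=.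
  apply: contraTT; rewrite -leNgt -ltNge => /ltW/cdf_homo.
  by rewrite /mark bE; lra.
Qed.

End cdf_transform.

(** * Independence from the past *)

Section past.
Context d (T : measurableType d) (R : realType).
Implicit Types X : nat -> T -> R.

Definition past_system X (i : nat) : set_system T :=
  \bigcup_(j in [set j | (j < i)%N]) preimage_set_system setT (X j) measurable.

(** A measurable type carried by T, so that being determined by the past is measurability on this
    type. The observation at time i is excluded, whence the shift by one against
    [natural_filtration]. *)
Definition past X (i : nat) : measurableType _ := g_sigma_algebraType (past_system X i).

Lemma past_filtration X i : natural_filtration X i = @measurable _ (past X i.+1).
Proof. by []. Qed.

Lemma past_le X i j (A : set T) : (i <= j)%N ->
  measurable (A : set (past X i)) -> measurable (A : set (past X j)).
Proof.
move=> ij; apply: smallest_sub; first exact: (@sigma_algebra_measurable _ (past X j)).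
move=> B [k /= ki kB]; apply: sub_sigma_algebra.
by exists k => //=; exact: leq_trans ki ij.
Qed.

Lemma measurable_past_obs X i : measurable_fun setT (X i : past X i.+1 -> R).
Proof.
move=> _ B mB; apply: sub_sigma_algebra; exists i => //=.
by exists B.
Qed.

End past.

Section independence.
Context d (T : measurableType d) (R : realType) (P : probability T R).
Context (X : nat -> {RV P >-> R}).
Context (X_indep : independent_seq X).
Local Open Scope ereal_scope.

Lemma past_measurable i (A : set T) : measurable (A : set (past X i)) -> measurable A.
Proof.
apply: smallest_sub; first exact: sigma_algebra_measurable.
move=> B [j _ [C mC <-]]; rewrite setTI.
by rewrite -[Y in measurable Y]setTI; exact: measurable_funP.
Qed.

(** Uniqueness of measures: both sides are finite measures in A, and they agree on the finite
    intersections of events of the first i observations, a generating pi-system. *)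
Lemma past_indep i (A : set T) (B : set R) :
  measurable (A : set (past X i)) -> measurable B ->
  P (A `&` X i @^-1` B) = P A * P (X i @^-1` B).
Proof.
move=> mA mB.
have mX j (C : set R) : measurable C -> measurable (X j @^-1` C).
  by move=> mC; rewrite -[Y in measurable Y]setTI; exact: measurable_funP.
pose J := [fset j in iota 0 i]%fset.
have iJ : i \notin J by rewrite in_fset/= mem_iota add0n ltnn.
pose G : set_system T := [set A | exists2 C : nat -> set R,
  forall j, measurable (C j) & A = \bigcap_(j in [set` J]) (X j @^-1` C j)].
have mG : G `<=` measurable.
  move=> _ [C mC ->]; apply: fin_bigcap_measurable => //= j _; exact: mX.
have PE : P (X i @^-1` B) = (fine (P (X i @^-1` B)))%:E.
  by rewrite fineK// fin_num_measure//; exact: mX.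
pose m1 := mrestr P (mX i B mB).
pose m2 := mscale (NngNum (fine_ge0 (measure_ge0 P (X i @^-1` B)))) P.
have -> : P (A `&` X i @^-1` B) = m1 A by [].
have -> : P A * P (X i @^-1` B) = m2 A by rewrite PE muleC.
apply: (@g_sigma_algebra_measure_unique _ _ _ G mG (fun=> setT)) => //.
- by move=> _; exists (fun=> setT) => //; apply/seteqP; split.
- by rewrite bigcup_const//; exists 0%N.
- move=> _ _ [C mC ->] [D mD ->]; exists (fun j => C j `&` D j).
    by move=> j; exact: measurableI.
  by rewrite bigcapI.
- move=> _ [C mC ->].
  transitivity (P (\bigcap_(j in [set` J]) (X j @^-1` C j)) * P (X i @^-1` B)).
    2: by rewrite PE muleC.
  rewrite X_indep//.
  (* Independence is applied to J enlarged by i, with B as the set at i. *)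
  pose C' j := if j == i then B else C j.
  have mC' j : measurable (C' j) by rewrite /C'; case: ifP.
  have := X_indep (i |` J)%fset mC'.
  rewrite big_fsetU1//= {2}/C' eqxx muleC.
  rewrite [X in _ = X * _ -> _](_ : _ = \prod_(j <- J) P (X j @^-1` C j)); last first.
    rewrite !big_seq; apply: eq_bigr => j jJ.
    by rewrite /C'; case: eqP => // ji; rewrite -ji jJ in iJ.
  move=> <-; rewrite /m1 /mrestr; congr (P _).
  apply/seteqP; split => w /=.
    move=> [wC wB] j /=; rewrite in_fset1U /C'; case: eqP => [-> _ //|_ /= jJ].
    exact: wC.
  move=> wC; split.
    move=> j /= jJ; have := wC j; rewrite /= in_fset1U jJ orbT => /(_ isT).
    by rewrite /C'; case: eqP => // ji; rewrite -ji jJ in iJ.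
  by have := wC i; rewrite /= in_fset1U eqxx /C' eqxx => /(_ isT).
- move=> _; apply: (@le_lt_trans _ _ 1); last exact: ltry.
  by rewrite -[leLHS]/(P (setT `&` X i @^-1` B)) setTI; exact: probability_le1 (mX _ _ mB).
- apply: smallest_sub mA; first exact: (@sigma_algebra_measurable _ (g_sigma_algebraType G)).
  move=> _ [j /= ji [C mC <-]]; apply: sub_sigma_algebra.
  exists (fun k => if k == j then C else setT); first by move=> k; case: ifP.
  rewrite setTI; apply/seteqP; split => w /=; last first.
    by move=> /(_ j); rewrite /= in_fset/= mem_iota add0n ji eqxx; apply.
  by move=> wC k _ /=; case: eqP => // ->.
Qed.

End independence.

(** * Integrating out the next mark given the past *)

Section one_step.
Context d (T : measurableType d) (R : realType) (P : probability T R).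
Context (X : nat -> {RV P >-> R}) (F : R -> R).
Context (F_continuous : continuous F).
Context (X_cdf : forall i x, cdf (X i) x = (F x)%:E).
Context (X_indep : independent_seq X).
Local Open Scope ereal_scope.

Lemma past_measurable_fun i d' (U : measurableType d') (Y : T -> U) :
  measurable_fun setT (Y : past X i -> U) -> measurable_fun setT Y.
Proof.
move=> mY _ B mB; rewrite setTI; apply: (@past_measurable _ _ _ _ X i).
by rewrite -[Z in measurable Z]setTI; apply: mY.
Qed.

(** The direction b is known from the past, and on each of its two values the mark is uniform and
    independent of the past. So Y and the mark have a product law, and Tonelli applies. *)
Lemma integral_past_mark i (Y : T -> R) (b : T -> bool) (psi : R -> R -> \bar R) :
  measurable_fun setT (Y : past X i -> R) ->
  measurable ([set w | b w] : set (past X i)) ->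
  measurable_fun [set: R * R] (fun z => psi z.1 z.2) ->
  (forall y u, 0 <= psi y u) ->
  \int[P]_w psi (Y w) (mark F (b w) (X i w)) = \int[P]_w \int[unif]_u psi (Y w) u.
Proof.
move=> mYi mbi mpsi psi0.
have mY := past_measurable_fun mYi.
have mb := past_measurable mbi.
pose W w : measurableTypeR R := mark F (b w) (X i w).
have mmark c : measurable_fun setT (mark F c \o X i).
  by apply: measurableT_comp => //; exact: measurable_mark.
have WE (B : set (measurableTypeR R)) : W @^-1` B =
    ([set w | b w] `&` (mark F true \o X i) @^-1` B) `|`
    (~` [set w | b w] `&` (mark F false \o X i) @^-1` B).
  apply/seteqP; split => w /=; rewrite /W; case: (b w) => /=.
  - by left.
  - by right.
  - by case=> -[].
  - by case=> -[].
have mmarks c (B : set (measurableTypeR R)) : measurable B ->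
    measurable ((mark F c \o X i) @^-1` B).
  by move=> mB; rewrite -[Z in measurable Z]setTI; apply: mmark.
have mW : measurable_fun setT W.
  move=> _ B mB; rewrite setTI WE; apply: measurableU; apply: measurableI => //;
    by [exact: mmarks|exact: measurableC].
pose Z w : R * measurableTypeR R := (Y w, W w).
have mZ : measurable_fun setT Z by apply/measurable_fun_pairP.
pose mY' : {mfun T >-> R} := HB.pack Y (isMeasurableFun.Build _ _ _ _ _ mY).
pose mZ' : {mfun T >-> (R * measurableTypeR R)%type} :=
  HB.pack Z (isMeasurableFun.Build _ _ _ _ _ mZ).
have mpsi' : measurable_fun [set: R * measurableTypeR R] (fun z => psi z.1 z.2) := mpsi.
have prodE S : measurable S -> (distribution P mY' \x unif) S = distribution P mZ' S.
  move=> mS; apply: product_measure_unique => // A B mA mB.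
  transitivity (P (Y @^-1` A `&` W @^-1` B)); first by [].
  have mYA : measurable (Y @^-1` A : set (past X i)).
    by rewrite -[Q in measurable Q]setTI; apply: mYi.
  have mYAb : measurable (Y @^-1` A `&` [set w | b w] : set (past X i)).
    exact: measurableI.
  have mYAn : measurable (Y @^-1` A `&` ~` [set w | b w] : set (past X i)).
    by apply: measurableI => //; exact: measurableC.
  have indep c (D : set (past X i)) : measurable D ->
      P (D `&` (mark F c \o X i) @^-1` B) = P D * unif B.
    move=> mD; rewrite -(mark_unif F_continuous (X_cdf i) c mB).
    have mcB : measurable (mark F c @^-1` B).
      by rewrite -[Q in measurable Q]setTI; exact: measurable_mark.
    exact: (past_indep X_indep mD mcB).
  rewrite WE setIUr !setIA measureU.
  - transitivity (P (Y @^-1` A `&` [set w | b w]) * unif B +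
        P (Y @^-1` A `&` ~` [set w | b w]) * unif B).
      by congr (_ + _); [exact: (indep true)|exact: (indep false)].
    rewrite -ge0_muleDl//; congr (_ * _).
    rewrite -measureU.
    + rewrite -setIUr setUv setIT //.
    + exact: past_measurable mYAb.
    + exact: past_measurable mYAn.
    + by rewrite setIACA setICr setI0.
  - by apply: measurableI; [exact: past_measurable mYAb|exact: mmarks].
  - by apply: measurableI; [exact: past_measurable mYAn|exact: mmarks].
  - by rewrite setIACA (setIACA (Y @^-1` A)) setICr setI0 set0I.
transitivity (\int[distribution P mZ']_z psi z.1 z.2).
  by rewrite ge0_integral_pushforward.
transitivity (\int[distribution P mY' \x unif]_z psi z.1 z.2).
  by apply: eq_measure_integral => S mS _; exact: esym (prodE _ mS).
rewrite fubini_tonelli1//= ge0_integral_pushforward//.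
  apply: (@measurable_fun_fubini_tonelli_F _ _ R _ R unif (fun z => psi z.1 z.2)) => //.
by move=> y _; exact: integral_ge0.
Qed.

End one_step.

(** * Selection processes *)

Section counting.
Context (T : Type).
Implicit Types (D : nat -> T -> bool) (w : T).

(** A selection process is encoded by [D i w], telling whether observation i is selected. Only
    decisions before time i are counted, so the count is known from the past of i. *)
Definition count D i w : nat := (\sum_(j < i) D j w)%N.

Lemma count0 D w : count D 0 w = 0%N.
Proof. by rewrite /count big_ord0. Qed.

Lemma countS D i w : count D i.+1 w = (count D i w + D i w)%N.
Proof. by rewrite /count big_ord_recr. Qed.

Lemma count_le D w i j : (i <= j)%N -> (count D i w <= count D j w)%N.
Proof.
move=> /subnK <-; elim: (j - i)%N => // m IHm.
by rewrite addSn countS (leq_trans IHm) ?leq_addr.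
Qed.

Lemma count_lt D w i j : (i < j)%N -> D i w -> (count D i w < count D j w)%N.
Proof. by move=> ij Di; rewrite (leq_trans _ (count_le D w ij))// countS Di addn1. Qed.

Lemma count_reach D w j k : (k < count D j w)%N ->
  exists i, [/\ (i < j)%N, D i w & count D i w = k].
Proof.
elim: j => [|j IHj]; first by rewrite count0.
rewrite countS; case: (ltnP k (count D j w)) => [/IHj[i [ij Di ci]] _|kc].
  by exists i; split=> //; exact: ltnW.
case Dj : (D j w); last by rewrite addn0 ltnNge kc.
by rewrite addn1 ltnS => ck; exists j; split=> //; apply/eqP; rewrite eqn_leq ck kc.
Qed.

End counting.

Section process.
Context d (T : measurableType d) (R : realType) (P : probability T R).
Context (X : nat -> {RV P >-> R}) (F : R -> R).
Context (F_continuous : continuous F).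
Context (X_cdf : forall i x, cdf (X i) x = (F x)%:E).
Context (X_indep : independent_seq X).
Implicit Types (D : nat -> T -> bool) (w : T).

(* [odd (count D i w)] is the direction of the next selection. *)
Definition score D i w : R := mark F (odd (count D i w)) (X i w).

(** No mark is below the initial level 0, so the first selection is unrestricted. *)
Fixpoint level D i w : R :=
  if i is j.+1 then (if D j w then 1 - score D j w else level D j w) else 0.

(** Cut off at i because the decision of the greedy rule at time i is built from its own earlier
    decisions: adaptedness is then proved by induction on i. *)
Definition adapted_before D i :=
  forall j, (j < i)%N -> measurable ([set w | D j w] : set (past X j.+1)).

(** The counts leave no room for a selection strictly between i and j, so the level set at time i
    persists. *)
Lemma level_next D w i j : (i < j)%N -> D i w -> count D j w = (count D i w).+1 ->
  level D j w = 1 - score D i w.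
Proof.
move=> ij Di; elim: j ij => // j IHj; rewrite ltnS leq_eqVlt => /predU1P[<- _|ij].
  by rewrite /= Di.
rewrite countS /=; case: (D j w) => [/eqP|]; last by rewrite addn0; exact: IHj.
by rewrite addn1 eqSS eqn_leq leqNgt count_lt.
Qed.

Lemma measurable_count D i k : adapted_before D i ->
  measurable ([set w | count D i w = k] : set (past X i)).
Proof.
elim: i k => [|i IHi] k aD.
  have [->|k0] := eqVneq k 0%N.
    by rewrite (_ : [set w | _] = setT)//; apply/seteqP; split => // w _; exact: count0.
  rewrite (_ : [set w | _] = set0)//; apply/seteqP; split => // w /=.
  by rewrite count0 => k0'; rewrite -k0' in k0.
have aD' : adapted_before D i by move=> j ji; apply: aD; exact: ltnW.
have mc k' : measurable ([set w | count D i w = k'] : set (past X i.+1)).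
  by apply: (@past_le _ _ _ _ i) => //; exact: IHi.
have mD : measurable ([set w | D i w] : set (past X i.+1)) by exact: aD.
have mD' : measurable (~` [set w | D i w] : set (past X i.+1)) by exact: measurableC.
(* The clause [0 < k] excludes k = 0, for which [k.-1] would be 0 again. *)
rewrite (_ : [set w | _] = ([set w | D i w] `&` [set w | count D i w = k.-1 /\ (0 < k)%N])
    `|` (~` [set w | D i w] `&` [set w | count D i w = k])).
  apply: measurableU; apply: measurableI => //.
  case: (posnP k) => k0.
    by rewrite (_ : [set w | _] = set0)//; apply/seteqP; split => // w [].
  rewrite (_ : [set w | _] = [set w | count D i w = k.-1])//.
  by apply/seteqP; split => [w []|w].
apply/seteqP; split => w /=; rewrite countS; case: (D i w) => /=.
- by rewrite addn1 => <-; left.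
- by rewrite addn0; right; split.
- by case=> -[// _ [-> k0]]; rewrite addn1 prednK.
- by case=> -[// _ ->]; rewrite addn0.
Qed.

Lemma measurable_odd_count D i : adapted_before D i ->
  measurable ([set w | odd (count D i w)] : set (past X i)).
Proof.
move=> aD; rewrite (_ : [set w | _] =
    \bigcup_(k in [set k | odd k]) [set w | count D i w = k]).
  by apply: bigcup_measurable => k _; exact: measurable_count.
by apply/seteqP; split => [w ow|w [k ok /= ->]//]; exists (count D i w).
Qed.

Lemma measurable_score D i : adapted_before D i ->
  measurable_fun setT (score D i : past X i.+1 -> R).
Proof.
move=> aD.
have mb : measurable ([set w | odd (count D i w)] : set (past X i.+1)).
  by apply: (@past_le _ _ _ _ i) => //; exact: measurable_odd_count.
have mm b : measurable_fun setT ((fun w => mark F b (X i w)) : past X i.+1 -> R).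
  by apply: measurableT_comp; [exact: measurable_mark|exact: measurable_past_obs].
rewrite (_ : score D i = fun w => if odd (count D i w) then mark F true (X i w)
    else mark F false (X i w)).
  apply: measurable_fun_if => //; try exact: measurable_funTS.
  by apply: measurable_fun_bool true _; rewrite setTI.
by apply/funext => w; rewrite /score; case: odd.
Qed.

Lemma measurable_level D i : adapted_before D i ->
  measurable_fun setT (level D i : past X i -> R).
Proof.
elim: i => [|i IHi] aD; first exact: measurable_cst.
have aD' : adapted_before D i by move=> j ji; apply: aD; exact: ltnW.
apply: measurable_fun_if => //.
- by apply: measurable_fun_bool true _; rewrite setTI; exact: aD.
- by apply: measurable_funTS; apply: measurable_funB => //; exact: measurable_score.
- apply: measurable_funTS => _ B mB; apply: (@past_le _ _ _ _ i) => //.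
  exact: IHi.
Qed.

End process.

(** * Verification: no adapted rule beats the recursion, and the greedy rule attains it *)

Section verification.
Context d (T : measurableType d) (R : realType) (P : probability T R).
Context (X : nat -> {RV P >-> R}) (F : R -> R).
Context (F_continuous : continuous F).
Context (X_cdf : forall i x, cdf (X i) x = (F x)%:E).
Context (X_indep : independent_seq X).
Implicit Types (D : nat -> T -> bool) (w : T).
Local Open Scope ereal_scope.

Local Notation score := (score X F).
Local Notation level := (level X F).

Lemma measurable_count_real D i : adapted_before X D i ->
  measurable_fun setT (fun w => (count D i w)%:R%:E : \bar R).
Proof.
move=> aD; apply/measurable_EFinP; rewrite (_ : (fun w => _) =
    (fun w => \sum_(j < i) (\1_[set w | D j w] w : R))%R); last first.
  apply/funext => w; rewrite /count natr_sum; apply: eq_bigr => j _.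
  by rewrite indicE/= mem_setE.
apply: measurable_sum => j; apply: measurable_indic.
exact: past_measurable (aD _ (ltn_ord j)).
Qed.

(** The level is known from the past and the score is uniform given it. The integrand g is left open
    to serve both [gain], for the upper bound, and [gain_lt], for the greedy rule. *)
Lemma expected_step D i m (g : R -> R -> \bar R) : adapted_before X D i ->
  measurable_fun [set: R * R] (fun z => g z.1 z.2) -> (forall y u, 0 <= g y u) ->
  (forall y, \int[unif]_u g y u = value m y) ->
  \int[P]_w ((count D i w)%:R%:E + g (level D i w) (score D i w)) =
  \int[P]_w ((count D i w)%:R%:E + value m (level D i w)).
Proof.
move=> aD mg g0 gE.
have mC := measurable_count_real aD.
have mL := past_measurable_fun (measurable_level F_continuous aD).
have mS := past_measurable_fun (measurable_score F_continuous aD).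
have mO := measurable_odd_count aD.
have mg' : measurable_fun setT (fun w => g (level D i w) (score D i w)).
  apply: (measurableT_comp mg (_ : measurable_fun setT (fun w => (level D i w, score D i w)))).
  exact/measurable_fun_pairP.
have mv' : measurable_fun setT (fun w => value m (level D i w)).
  by apply: measurableT_comp mL; exact: measurable_value.
rewrite ge0_integralD// [RHS]ge0_integralD//; last by move=> w _; exact: value_ge0.
congr (_ + _).
rewrite (integral_past_mark F_continuous X_cdf X_indep
  (measurable_level F_continuous aD) mO mg g0).
by apply: eq_integral => w _; rewrite gE.
Qed.

(* Its expectation is nonincreasing in [i], and constant for the greedy rule. *)
Definition potential D n i w : \bar R :=
  (count D i w)%:R%:E + value (n - i) (level D i w).

Lemma potential0 D n : \int[P]_w potential D n 0 w = value n 0%R.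
Proof.
rewrite (_ : potential D n 0 = cst (value n 0%R)).
  by rewrite integral_cst//= probability_setT mule1.
by apply/funext => w; rewrite /potential count0 add0e subn0.
Qed.

Lemma potentialn D n : \int[P]_w potential D n n w = 'E_P[fun w => (count D n w)%:R].
Proof.
by rewrite unlock; apply: eq_integral => w _; rewrite /potential subnn adde0.
Qed.

Lemma measurable_potential D n i : adapted_before X D i ->
  measurable_fun setT (potential D n i).
Proof.
move=> aD; apply: emeasurable_funD; first exact: measurable_count_real.
apply: measurableT_comp; first exact: measurable_value.
exact: past_measurable_fun (measurable_level F_continuous aD).
Qed.

(** Whatever is decided at time i, the next potential comes from a term allowed in [gain]; averaging
    over the mark gives back at most the current potential. The potential starts at [value n 0] and
    ends as the count. *)
Lemma expected_count_le D n : adapted_before X D n ->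
  (forall i w, (i < n)%N -> D i w -> (level D i w <= score D i w)%R) ->
  'E_P[fun w => (count D n w)%:R] <= value n 0%R.
Proof.
move=> aD Dle; rewrite -potentialn -(potential0 D n).
have : forall i, (i <= n)%N -> \int[P]_w potential D n i w <= \int[P]_w potential D n 0 w.
  elim=> // i IHi ni; apply: le_trans (IHi (ltnW ni)).
  have aDi : adapted_before X D i by move=> j ji; apply: aD; exact: ltn_trans ji ni.
  have aDS : adapted_before X D i.+1 by move=> j ji; apply: aD; exact: leq_trans ji ni.
  rewrite -(@expected_step D i (n - i) (gain (value (n - i.+1)))) //; last 3 first.
  - exact: measurable_gain (measurable_value _).
  - by move=> y u; apply: gain_ge0 => z; exact: value_ge0.
  - by move=> y; rewrite -[in RHS](subnSK ni).
  apply: ge0_le_integral => //.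
  - by move=> w _; rewrite adde_ge0// ?lee_fin// value_ge0.
  - exact: measurable_potential.
  - apply: emeasurable_funD; first exact: measurable_count_real.
    apply: (measurableT_comp (measurable_gain (measurable_value _))
      (_ : measurable_fun setT (fun w => (level D i w, score D i w)))).
    apply/measurable_fun_pairP; split.
      exact: past_measurable_fun (measurable_level F_continuous aDi).
    exact: past_measurable_fun (measurable_score F_continuous aDi).
  move=> w _; rewrite /potential countS /=.
  case Di : (D i w) => /=.
    rewrite /gain Dle// natrD EFinD -addeA leeD2l// le_max; apply/orP; right.
    by [].
  rewrite addn0 leeD2l// /gain; case: ifP => // _.
  by rewrite le_max lexx.
by move=> /(_ n (leqnn n)).
Qed.

(** Here n - i - 1 observations remain after the current one. The clause [i < n] stops the rule at
    the horizon, where the truncated difference would stay 0. *)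
Definition greedy_rule n i (y u : R) : bool :=
  [&& (i < n)%N, (y < u)%R & value (n - i.+1) y <= 1 + value (n - i.+1) (1 - u)%R].

(** The decisions depend on the count and level that they themselves generate. This recursion
    carries the pair along explicitly, and [greedy_stateE] identifies it afterwards. *)
Fixpoint greedy_state n i w : nat * R :=
  if i is j.+1 then
    let s := greedy_state n j w in let u := mark F (odd s.1) (X j w) in
    if greedy_rule n j s.2 u then (s.1.+1, 1 - u)%R else s
  else (0%N, 0%R).

Definition greedy n i w : bool :=
  let s := greedy_state n i w in greedy_rule n i s.2 (mark F (odd s.1) (X i w)).

Lemma greedy_stateE n i w :
  greedy_state n i w = (count (greedy n) i w, level (greedy n) i w).
Proof.
elim: i => [|i IHi]; first by rewrite count0.
rewrite countS /= -[greedy_rule _ _ _ _]/(greedy n i w).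
case: (greedy n i w); last by rewrite addn0 IHi.
by rewrite IHi addn1.
Qed.

Lemma greedyE n i w :
  greedy n i w = greedy_rule n i (level (greedy n) i w) (score (greedy n) i w).
Proof. by rewrite /greedy greedy_stateE. Qed.

Lemma measurable_greedy_rule n i :
  measurable [set z : R * R | greedy_rule n i z.1 z.2].
Proof.
have [ni|ni] := ltnP i n; last first.
  rewrite (_ : [set _ | _] = set0)//; apply/seteqP; split => // z /=.
  by rewrite /greedy_rule ltnNge ni.
rewrite (_ : [set _ | _] = [set z : R * R | (z.1 < z.2)%R] `&`
    [set z : R * R | value (n - i.+1) z.1 <= 1 + value (n - i.+1) (1 - z.2)%R]); last first.
  apply/seteqP; split => z /=; rewrite /greedy_rule ni /=.
    by move=> /andP[].
  by move=> [-> ->].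
apply: measurableI.
  have m : measurable_fun [set: R * R] (fun z : R * R => (z.1 < z.2)%R).
    exact: measurable_fun_ltr.
  have := m measurableT [set true] I; rewrite setTI.
  by congr measurable; apply/seteqP.
have mv := @measurable_value R (n - i.+1).
have m1 : measurable_fun [set: R * R] (fun z => value (n - i.+1) z.1).
  exact: measurableT_comp mv _.
have m2 : measurable_fun [set: R * R] (fun z => 1 + value (n - i.+1) (1 - z.2)%R).
  apply: emeasurable_funD => //; apply: (measurableT_comp mv).
  exact: (measurableT_comp (@measurable_onem R)).
by rewrite -[X in measurable X]setTI; exact: emeasurable_fun_le.
Qed.

Lemma adapted_greedy n i : adapted_before X (greedy n) i.
Proof.
elim: i => // i IHi j; rewrite ltnS leq_eqVlt => /predU1P[->{j}|/IHi//].
have mL : measurable_fun setT (level (greedy n) i : past X i.+1 -> R).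
  move=> _ B mB; apply: (@past_le _ _ _ _ i) => //.
  exact: (measurable_level F_continuous IHi).
have mS := measurable_score F_continuous IHi.
have mLS : measurable_fun setT ((fun w => (level (greedy n) i w, score (greedy n) i w)) :
    past X i.+1 -> (R * R)%type).
  exact/measurable_fun_pairP.
have := mLS measurableT _ (measurable_greedy_rule n i); rewrite setTI.
by congr measurable; apply/seteqP; split => w /=; rewrite greedyE.
Qed.

(** The greedy decision realises the maximum in [gain_lt] pointwise, so the potential keeps its
    expectation. *)
Lemma expected_count_greedy n : 'E_P[fun w => (count (greedy n) n w)%:R] = value n 0%R.
Proof.
have aD := adapted_greedy n.
rewrite -potentialn -(potential0 (greedy n) n).
have : forall i, (i <= n)%N ->
    \int[P]_w potential (greedy n) n i w = \int[P]_w potential (greedy n) n 0 w.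
  elim=> // i IHi ni; rewrite -(IHi (ltnW ni)).
  rewrite -(@expected_step _ i (n - i) (gain_lt (value (n - i.+1)))) //; last 3 first.
  - exact: measurable_gain_lt (measurable_value _).
  - by move=> y u; apply: gain_lt_ge0 => z; exact: value_ge0.
  - move=> y; rewrite integral_gain_lt//; [|exact: measurable_value|exact: value_ge0].
    by rewrite -[in RHS](subnSK ni).
  apply: eq_integral => w _; rewrite /potential countS /=.
  have := greedyE n i w; rewrite /greedy_rule ni /= /gain_lt.
  case: (boolP (level (greedy n) i w < score (greedy n) i w)%R) => _ /= ->; last by rewrite addn0.
  case: leP => _ /=; last by rewrite addn0.
  by rewrite natrD EFinD -addeA.
by move=> /(_ n (leqnn n)).
Qed.

End verification.

(** * Policies given by stopping times *)

Lemma strictly_increasing_lt (t : nat -> option nat) a b i j :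
  strictly_increasing_while_finite t -> t a = Some i -> t b = Some j ->
  (a < b)%N -> (i < j)%N.
Proof.
move=> tinc ta; elim: b j => // b IHb j tb; rewrite ltnS leq_eqVlt => /predU1P[ab|ab].
  by have := tinc a; rewrite ta ab tb.
have := tinc b; rewrite tb; case tbE : (t b) => [k|//] kj.
exact: ltn_trans (IHb _ tbE ab) kj.
Qed.

Section policies.
Context d (T : measurableType d) (R : realType) (P : probability T R).
Context (X : nat -> {RV P >-> R}) (F : R -> R).
Context (F_continuous : continuous F).
Context (X_cdf : forall i x, cdf (X i) x = (F x)%:E).
Context (X_indep : independent_seq X).
Implicit Types (D : nat -> T -> bool) (w : T) (tau : nat -> T -> option nat).

(** The k-th time is at least k by [time_ge_rank], so ranks up to i suffice and the test is
    finite. *)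
Definition selected tau i w : bool := [exists k : 'I_i.+1, tau k w == Some i].

Lemma stopping_time_eq tau k i : stopping_time (natural_filtration X) (tau k) ->
  measurable ([set w | tau k w = Some i] : set (past X i.+1)).
Proof.
move=> st.
have m j : (j <= i)%N -> measurable ([set w | time_le (tau k w) j] : set (past X i.+1)).
  move=> ji; apply: (@past_le _ _ _ _ j.+1) => //; exact: st.
case: i m => [|i] m.
  rewrite (_ : [set w | _] = [set w | time_le (tau k w) 0]); first exact: m.
  apply/seteqP; split => w /=; case: (tau k w) => //= j; first by move=> [->].
  by rewrite leqn0 => /eqP ->.
rewrite (_ : [set w | _] =
    [set w | time_le (tau k w) i.+1] `\` [set w | time_le (tau k w) i]).
  by apply: measurableD; apply: m.
apply/seteqP; split => w /=.
  by move=> ->; rewrite /= leqnn ltnn.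
case: (tau k w) => [j /= [ji /negP]|[]//].
by rewrite -ltnNge => ij; congr Some; apply/eqP; rewrite eqn_leq ji.
Qed.

Lemma adapted_selected tau i : (forall k, stopping_time (natural_filtration X) (tau k)) ->
  adapted_before X (selected tau) i.
Proof.
move=> st j _; rewrite (_ : [set w | _] =
    \bigcup_(k in [set k | (k < j.+1)%N]) [set w | tau k w = Some j]).
  by apply: bigcup_measurable => k _; exact: stopping_time_eq.
apply/seteqP; split => w /=.
  by move=> /existsP[k /eqP tk]; exists k => /=.
by move=> [k /= kj tk]; apply/existsP; exists (Ordinal kj); apply/eqP.
Qed.

Lemma time_ge_rank (t : nat -> option nat) k i :
  strictly_increasing_while_finite t -> t k = Some i -> (k <= i)%N.
Proof.
move=> tinc; elim: k i => // k IHk i tk.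
have := tinc k; rewrite tk; case tkE : (t k) => [j|//] ji.
exact: leq_ltn_trans (IHk _ tkE) ji.
Qed.

Lemma selectedP tau i w : strictly_increasing_while_finite (tau ^~ w) ->
  reflect (exists k, tau k w = Some i) (selected tau i w).
Proof.
move=> tinc; apply: (iffP existsP) => [[k /eqP tk]|[k tk]]; first by exists k.
have ki := time_ge_rank tinc tk.
by exists (Ordinal (ki : (k < i.+1)%N)); apply/eqP.
Qed.

Lemma count_selectedP tau i w k : strictly_increasing_while_finite (tau ^~ w) ->
  (k < count (selected tau) i w)%N <-> exists2 j, tau k w = Some j & (j < i)%N.
Proof.
move=> tinc; elim: i k => [|i IHi] k.
  by rewrite count0; split => // -[].
(* A selected i has as rank the number of earlier selections. A smaller rank would already be
   counted before i. A larger one would make the time of rank [count] finite, since [None] persists,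
   and smaller than i, hence counted too. *)
have next : selected tau i w -> tau (count (selected tau) i w) w = Some i.
  move=> /(selectedP _ tinc)[l tl].
  case: (ltngtP l (count (selected tau) i w)) => [/IHi[j]|lt|<-//].
    by rewrite tl => -[->]; rewrite ltnn.
  case tcE : (tau (count (selected tau) i w) w) => [j|].
    have ji := strictly_increasing_lt tinc tcE tl lt.
    have : (count (selected tau) i w < count (selected tau) i w)%N by apply/IHi; exists j.
    by rewrite ltnn.
  have {tl} : tau l w != None by rewrite tl.
  suff -> : tau l w = None by [].
  elim: l lt => // l IHl; rewrite ltnS leq_eqVlt => /predU1P[cl|/IHl tlN].
    by have := tinc l; rewrite -cl tcE; case: (tau _ w).
  by have := tinc l; rewrite tlN; case: (tau _ w).
rewrite countS; case sel : (selected tau i w).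
  rewrite addn1 ltnS leq_eqVlt; split.
    by move=> /predU1P[->|/IHi[j tj ji]]; [exists i => //; exact: next|exists j => //; exact: ltnW].
  move=> [j tj]; rewrite ltnS leq_eqVlt => /predU1P[ji|ji]; apply/orP; last first.
    by right; apply/IHi; exists j.
  left; rewrite ji in tj; have tc := next sel.
  case: (ltngtP k (count (selected tau) i w)) => // /(strictly_increasing_lt tinc).
    by move=> /(_ _ _ tj tc); rewrite ltnn.
  by move=> /(_ _ _ tc tj); rewrite ltnn.
rewrite addn0 IHi; split => -[j tj ji]; exists j => //; first exact: ltnW.
move: ji; rewrite ltnS leq_eqVlt => /predU1P[ji|//].
by move/(selectedP _ tinc): sel; case; exists k; rewrite -ji.
Qed.

Lemma selections_count tau n w : strictly_increasing_while_finite (tau ^~ w) ->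
  selections R n tau w = (count (selected tau) n w)%:R.
Proof.
move=> tinc; rewrite /selections; congr (_%:R); apply: card_fset_set.
rewrite (_ : [set _ | _] = `I_(count (selected tau) n w))//.
by apply/seteqP; split => k /= /(count_selectedP _ _ tinc).
Qed.

(** Consecutive selected values compare strictly, but F may be flat between them, so their marks
    compare only weakly. This is why the upper bound works with [gain]. *)
Lemma level_score_le tau i w : feasible X tau -> selected tau i w ->
  level X F (selected tau) i w <= score X F (selected tau) i w.
Proof.
move=> [_ tinc talt] sel.
have Fh := @cdf_homo _ _ _ _ (X 0%N) F (X_cdf 0).
have m01 b x := @mark_itv _ _ _ _ (X 0%N) F (X_cdf 0) b x.
set c := count (selected tau) i w.
have tc : tau c w = Some i.
  have : (c < count (selected tau) i.+1 w)%N by rewrite count_lt.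
  move=> /(count_selectedP _ _ (tinc w))[j tj]; rewrite ltnS leq_eqVlt => /predU1P[<-//|ji].
  have : (c < c)%N by apply/(count_selectedP _ _ (tinc w)); exists j.
  by rewrite ltnn.
case cE : c => [|m].
  suff -> : level X F (selected tau) i w = 0 by have := m01 (odd c) (X i w); rewrite /score -/c; lra.
  have : forall j, (j <= i)%N -> level X F (selected tau) j w = 0.
    elim=> // j IHj ji /=; case sj : (selected tau j w); last exact: IHj (ltnW ji).
    by have := count_lt ji sj; rewrite -/c cE.
  by apply.
have [j [ji sj cj]] : exists j, [/\ (j < i)%N, selected tau j w & count (selected tau) j w = m].
  by apply: count_reach; rewrite -/c cE.
(* The previous selection, at j, had the opposite direction, so 1 minus its score is its mark in the
   current direction. *)
rewrite (level_next X F ji sj); last by rewrite -/c cE cj.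
have tm : tau m w = Some j.
  have : (m < count (selected tau) j.+1 w)%N by rewrite -cj count_lt.
  move=> /(count_selectedP _ _ (tinc w))[l tl]; rewrite ltnS leq_eqVlt => /predU1P[<-//|lj].
  have : (m < m)%N by rewrite -{2}cj; apply/(count_selectedP _ _ (tinc w)); exists l.
  by rewrite ltnn.
have := talt w m j i tm; rewrite -cE => /(_ tc).
rewrite /score -/c cj cE /= /mark; case: (odd m) => /= /ltW/Fh; lra.
Qed.

Lemma feasible_le n tau : feasible X tau -> ('E_P[selections R n tau] <= value n 0)%E.
Proof.
move=> ftau; have [st tinc talt] := ftau.
rewrite (_ : selections R n tau = fun w => (count (selected tau) n w)%:R); last first.
  by apply/funext => w; rewrite selections_count.
apply: (expected_count_le F_continuous X_cdf X_indep).
  exact: adapted_selected.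
by move=> i w _; exact: level_score_le.
Qed.

(** The way back from indicators to times. The count strictly increases at selections, so at most
    one index qualifies and [pick] makes no real choice. *)
Definition policy n D k w : option nat :=
  omap val [pick i : 'I_n | D i w && (count D i w == k)].

Lemma policyP n D k w i :
  policy n D k w = Some i <-> [/\ (i < n)%N, D i w & count D i w = k].
Proof.
rewrite /policy; case: pickP => [j /andP[Dj /eqP cj]|none] /=; split => //.
- by move=> [<-]; split.
- move=> [ni Di ci]; congr Some.
  case: (ltngtP i j) => // /(@count_lt T D w); [move=> /(_ Di)|move=> /(_ Dj)];
    by rewrite ci cj ltnn.
- by move=> [ni Di /eqP ci]; have := none (Ordinal ni); rewrite /= Di ci.
Qed.

(** A strict inequality between marks does pass to the observations, by monotonicity of F alone;
    hence the strict hypothesis. *)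
Lemma feasible_policy n D : (forall i, adapted_before X D i) ->
  (forall i w, D i w -> level X F D i w < score X F D i w) ->
  feasible X (policy n D).
Proof.
move=> aD Dlt; split.
- move=> k i; rewrite past_filtration (_ : [set w | _] =
    \bigcup_(j in [set j | (j <= i)%N && (j < n)%N])
      ([set w | D j w] `&` [set w | count D j w = k])).
    apply: bigcup_measurable => j /= /andP[ji _]; apply: (@past_le _ _ _ _ j.+1) => //.
    apply: measurableI; first exact: (aD j.+1).
    by apply: (@past_le _ _ _ _ j) => //; exact: measurable_count.
  apply/seteqP; split => w /=.
    case pE : (policy n D k w) => [j|//] /= ji.
    by have /policyP[nj Dj cj] := pE; exists j => //=; rewrite ji nj.
  move=> [j /= /andP[ji nj] [Dj cj]].
  by have -> : policy n D k w = Some j by apply/policyP.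
- move=> w k; case pE : (policy n D k w) => [i|]; case qE : (policy n D k.+1 w) => [j|//].
    have /policyP[_ Di ci] := pE; have /policyP[_ Dj cj] := qE.
    rewrite ltnNge; apply/negP => ji; have := count_le D w ji.
    by rewrite ci cj ltnn.
  have /policyP[nj Dj cj] := qE.
  have [i [ij Di ci]] : exists i, [/\ (i < j)%N, D i w & count D i w = k].
    by apply: count_reach; rewrite cj.
  suff : policy n D k w = Some i by rewrite pE.
  by apply/policyP; split => //; exact: ltn_trans ij nj.
- move=> w k i j /policyP[_ Di ci] /policyP[_ Dj cj].
  have Fh := @cdf_homo _ _ _ _ (X 0%N) F (X_cdf 0).
  have ij : (i < j)%N.
    by rewrite ltnNge; apply/negP => ji; have := count_le D w ji; rewrite ci cj ltnn.
  have := Dlt j w Dj; rewrite (level_next X F ij Di) ?ci ?cj// /score ci cj /= /mark.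
  case: (odd k) => /= lt; rewrite ltNge; apply/negP => /Fh; lra.
Qed.

Lemma selections_policy n D w : selections R n (policy n D) w = (count D n w)%:R.
Proof.
rewrite /selections; congr (_%:R); apply: card_fset_set.
rewrite (_ : [set _ | _] = `I_(count D n w))//; apply/seteqP; split => k /=.
  by move=> [i /policyP[ni Di <-] _]; exact: count_lt.
move=> kc; have [i [ni Di ci]] := count_reach kc.
by exists i => //; apply/policyP.
Qed.

Lemma policy_greedy_feasible n : feasible X (policy n (greedy X F n)).
Proof.
apply: feasible_policy => [i|i w]; first exact: adapted_greedy.
by rewrite greedyE => /and3P[].
Qed.

Lemma expected_policy_greedy n :
  'E_P[selections R n (policy n (greedy X F n))]%E = value n 0.
Proof.
rewrite (_ : selections R n _ = fun w => (count (greedy X F n) n w)%:R); last first.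
  by apply/funext => w; rewrite selections_policy.
exact: expected_count_greedy.
Qed.

Lemma sup_expected n :
  ereal_sup [set 'E_P[selections R n rho]%E | rho in feasible X] = value n 0.
Proof.
apply/eqP; rewrite eq_le; apply/andP; split.
  by apply: ge_ereal_sup => _ [rho frho <-]; exact: feasible_le.
rewrite -expected_policy_greedy; apply: ereal_sup_ubound.
by exists (policy n (greedy X F n)) => //; exact: policy_greedy_feasible.
Qed.

End policies.

(** * Optimal policies, the two-sided bound and the asymptotics *)

Theorem theorem1 (R : realType) (d : measure_display) (T : measurableType d)
    (P : probability T R) (X : nat -> {RV P >-> R}) (F : R -> R)
    (F_continuous : continuous F)
    (X_cdf : forall i x, cdf (X i) x = (F x)%:E)
    (X_indep : independent_seq X) :
  [/\ forall n, (1 <= n)%N ->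
        exists pi : nat -> T -> option nat, optimal P X n pi,
      exists C : R, C < 11 - 4 * Num.sqrt 2 /\
        forall n, (1 <= n)%N ->
        forall pi : nat -> T -> option nat, optimal P X n pi ->
          (((2 - Num.sqrt 2) * n%:R)%:E <= 'E_P[selections R n pi])%E /\
          ('E_P[selections R n pi] <= ((2 - Num.sqrt 2) * n%:R + C)%:E)%E
    & forall pi : nat -> nat -> T -> option nat,
        (forall n, (1 <= n)%N -> optimal P X n (pi n)) ->
        (fun n => fine 'E_P[selections R n (pi n)] : R^o) ~_\oo
        (fun n => (2 - Num.sqrt 2) * n%:R : R^o)].
Proof.
have xiE : 2 * xi = 2 - Num.sqrt 2 :> R by rewrite /xi; lra.
have x0 := @xi_bounds R.
(* The process starts at level 0, where h vanishes, so only the constants of the value bounds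
   remain. *)
have r0 : relval 0 = 0 :> R by rewrite relval_le//; lra.
have bounds n pi : optimal P X n pi ->
    (((2 - Num.sqrt 2) * n%:R)%:E <= 'E_P[selections R n pi])%E /\
    ('E_P[selections R n pi] <= ((2 - Num.sqrt 2) * n%:R + 1)%:E)%E.
  move=> [_ ->]; rewrite (sup_expected F_continuous X_cdf X_indep) -xiE; split.
    by have := @value_lb R n 0; rewrite r0 addr0; apply; lra.
  by have := @value_ub R n 0; rewrite r0 addr0; apply; lra.
split.
- move=> n _; exists (policy n (greedy X F n)); split.
    exact: policy_greedy_feasible.
  by rewrite expected_policy_greedy// (sup_expected F_continuous).
(* The constant 1 bounds the oscillation of h; 11 - 4 sqrt 2 exceeds 5 because sqrt 2 < 3 / 2. *)
- exists 1; split; first by have := @sqrt2_bounds R; lra.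
  by move=> n _ pi; exact: bounds.
- move=> pi opt; apply/eqaddoP => e e0; near=> n.
  have n1 : (1 <= n)%N by near: n; exact: nbhs_infty_ge.
  have [lo hi] := bounds _ _ (opt n n1).
  have fE : 'E_P[selections R n (pi n)]%E \is a fin_num.
    by rewrite fin_numElt (lt_le_trans _ lo) ?ltNyr// (le_lt_trans hi) ?ltry.
  move: lo hi; rewrite -(fineK fE) !lee_fin.
  set f := fine _ => lo hi.
  have b0 : 0 < 2 - Num.sqrt 2 :> R by rewrite -xiE; lra.
  (* The error is at most 1, hence a fraction at most e of the main term once n is large. *)
  have en : 1 <= e * ((2 - Num.sqrt 2) * n%:R).
    rewrite mulrA mulrC -ler_pdivrMr ?mulr_gt0//; near: n; exact: nbhs_infty_ger.
  rewrite /= ger0_norm; last by rewrite subr_ge0.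
  rewrite ger0_norm; last by rewrite mulr_ge0// ltW.
  by apply: le_trans en; rewrite -[leLHS]/(f - (2 - Num.sqrt 2) * n%:R); lra.
Unshelve. all: by end_near.
Qed.
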